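(* Under the MNL model, for any $\lambda\ge0$, optimal solutions to $\max_{S\in\mathcal{P}(\mathcal{L})}V^*_{T(\lambda)}(S)$ also maximize the cumulative aggregated utility: $$\operatorname*{argmax}_{S\in\mathcal{P}(\mathcal{L})}V^*_{T(\lambda)}(S)=\operatorname*{argmax}_{S\in\mathcal{P}(\mathcal{L})}U_{T(\lambda)}(S).$$
   Context: Items and options: $\mathcal{L}=\{1,\dots,L\}$ is a finite set of unique items; item $j$ has salvage value $\xi_j\in\mathbb{R}$. An option is a sequence of distinct items (a single item, or a bundle of two or more items); the salvage value $\xi_i$ of an option $i$ is the sum of the salvage values of its items. $\mathcal{O}$ is the set of all options with at most $K_b$ items, and $\mathcal{P}(\mathcal{L})$ is the collection of all sets $S\subseteq\mathcal{O}$ such that each item belongs to exactly one option of $S$ and $S$ contains at most $K_s$ bundles ($K_b,K_s$ given integers). Customers: $\Omega$ is a finite set of customer types; $X$ is a random type with probability mass function $p_X$ on $\Omega$, and $\mathbb{E}_X$ is expectation over $X$. In each period a customer arrives with probability $\mu\in(0,1]$ (fixed), with type distributed as $X$ independently across periods. For demand $\lambda\ge 0$ the number of periods is $T(\lambda)=\lfloor\lambda/\mu\rfloor$; periods are indexed by remaining time $t$. Option $i$ has perceived quality $q_i^\omega\in\mathbb{R}$ for type $\omega$. The price sensitivity is $\beta_p<0$. MNL model: for a set $S$ of options and $p\in\mathbb{R}^{|S|}$, $\rho_i^\omega(p,S)=\dfrac{e^{q_i^\omega+\beta_p p_i}}{1+\sum_{j\in S}e^{q_j^\omega+\beta_p p_j}}$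 for $i\in S$. Value function: for every set $S'$ contained in some member of $\mathcal{P}(\mathcal{L})$, $V_0^*(S')=\sum_{i\in S'}\xi_i$ and, for $t\ge1$, $V_t^*(S')=V_{t-1}^*(S')+\mu\,\mathbb{E}_X\big[R(\rho^X,S',\Delta V_t^*(S'))\big]$, where $\Delta_iV_t^*(S')=V^*_{t-1}(S')-V^*_{t-1}(S'\setminus\{i\})$ for $i\in S'$ and $R(g,S',\Delta)=\max_{p\in\mathbb{R}^{|S'|}}\sum_{i\in S'}g_i(p,S')(p_i-\Delta_i)$. Cumulative aggregated utility: for $S\in\mathcal{P}(\mathcal{L})$, let $p_t^{\omega,*}$ be the maximizer in $R(\rho^\omega,S,\Delta V_t^*(S))$ (optimal prices at period $t$ for type $\omega$ when all of $S$ is offered), $u_{t,i}^{\omega,*}=q_i^\omega+\beta_p p_{t,i}^{\omega,*}$, and $$U_{T(\lambda)}(S)=\ln\sum_{t=1}^{T(\lambda)}\sum_{i\in S}\mathbb{E}_X\big[e^{u_{t,i}^{X,*}}\big],$$ with the convention $\ln 0=-\infty$ (relevant only when $T(\lambda)=0$). *)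

(* Defs.v *)
From mathcomp Require Import all_boot all_order all_algebra finmap.
From mathcomp Require Import boolp classical_sets reals ereal sequences exp.

Set Implicit Arguments.
Unset Strict Implicit.
Unset Printing Implicit Defensive.
Import Order.TTheory GRing.Theory Num.Theory.

Local Open Scope classical_set_scope.
Local Open Scope ring_scope.

Definition argmax {d : Order.disp_t} {A : Type} {B : porderType d}
    (D : set A) (f : A -> B) : set A :=
  [set x | D x /\ forall y, D y -> (f y <= f x)%O].

Section Options.
Variable L : nat.

(* Options live in the ambient type of all sequences of items; [is_option]
   selects the nonempty, duplicate-free sequences of at most Kb items. *)
Definition option_seq := seq 'I_L.

Definition is_option (Kb : int) (i : option_seq) : bool :=
  [&& uniq i, (0 < size i)%N & (size i)%:Z <= Kb].

Definition is_bundle (i : option_seq) : bool := (1 < size i)%N.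

Definition feasible (Kb Ks : int) : set {fset option_seq} :=
  [set S : {fset option_seq} |
    [/\ forall i, i \in S -> is_option Kb i,
        forall j : 'I_L, exists! i, i \in S /\ j \in i
      & (#|` [fset i in S | is_bundle i]%fset|)%:Z <= Ks]].

End Options.

Section Model.
Variables (R : realType) (L : nat) (Omega : finType).
Notation opt := (option_seq L).
Implicit Types (S : {fset opt}) (p D : opt -> R) (i : opt).

Definition salvage (xi : 'I_L -> R) i : R := \sum_(j <- i) xi j.

Definition expect (pX : Omega -> R) (f : Omega -> R) : R :=
  \sum_w pX w * f w.

(* A vector indexed by the options of S is represented by a function on all of
   [opt]; only its values on S are ever used.  [g p S i] is the probability that
   i is purchased when S is offered at prices p. *)
Definition choice_model := (opt -> R) -> {fset opt} -> opt -> R.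

(* The choice probabilities of a fixed customer type with qualities q. *)
Definition mnl (betap : R) (q : opt -> R) : choice_model := fun p S i =>
  expR (q i + betap * p i) / (1 + \sum_(j <- S) expR (q j + betap * p j)).

Definition revenue (g : choice_model) S D p : R :=
  \sum_(i <- S) g p S i * (p i - D i).

(* The maximum over all price vectors, written as a supremum; it is attained
   under the multinomial logit model. *)
Definition max_revenue (g : choice_model) S D : R :=
  sup (range (revenue g S D)).

(* The maximizing price vector (unique on S under the multinomial logit
   model; its values outside S are irrelevant). *)
Definition opt_price (g : choice_model) S D : opt -> R :=
  xget (fun=> 0) (argmax setT (revenue g S D)).

(* The opportunity cost Delta_i of selling option i, for a continuation value
   function V. *)
Definition opp_cost (V : {fset opt} -> R) S : opt -> R :=
  fun i => V S - V (S `\ i)%fset.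

Fixpoint value (mu : R) (pX : Omega -> R) (xi : 'I_L -> R)
    (g : Omega -> choice_model) (t : nat) (S : {fset opt}) {struct t} : R :=
  if t is t'.+1 then
    let V := value mu pX xi g t' in
    V S + mu * expect pX (fun w => max_revenue (g w) S (opp_cost V S))
  else \sum_(i <- S) salvage xi i.

(* The number of periods, floor (lambda / mu); [Num.truncn] is the nat-valued
   floor on nonnegative numbers. *)
Definition periods (mu lambda : R) : nat := Num.truncn (lambda / mu).

Definition opt_utility (mu : R) (pX : Omega -> R) (xi : 'I_L -> R) (betap : R)
    (q : Omega -> opt -> R) S (t : nat) (w : Omega) i : R :=
  let g v := mnl betap (q v) in
  q w i
  + betap * opt_price (g w) S (opp_cost (value mu pX xi g t.-1) S) i.

(* [lne] sends 0 to -oo. *)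
Definition agg_utility (mu : R) (pX : Omega -> R) (xi : 'I_L -> R) (betap : R)
    (q : Omega -> opt -> R) (T : nat) S : \bar R :=
  lne (\sum_(1 <= t < T.+1) \sum_(i <- S)
         expect pX (fun w => expR (opt_utility mu pX xi betap q S t w i)))%:E.

End Model.

(* Main.v *)
(** At an optimal MNL price vector all markups agree: they equal [r - 1 / betap],
    where [r] is the optimal revenue, characterised by
    [\sum_(i in S) expR (q i + betap * (D i + r) - 1) = - betap * r].  The
    summands are the optimal exponentiated utilities, so the optimal revenue of
    each period is [- 1 / betap] times their sum.  Summing over the periods,
    [value] is an increasing affine function of the argument of the logarithm in
    [agg_utility]; its constant term is the total salvage value of all items,
    which does not depend on the feasible set. *)
Require Import Defs.
From mathcomp Require Import all_boot all_order all_algebra finmap.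
From mathcomp Require Import boolp classical_sets reals ereal sequences exp.
From mathcomp Require Import topology normedtype ring lra.
Set Implicit Arguments.
Unset Strict Implicit.
Import Order.TTheory GRing.Theory Num.Theory. Import numFieldNormedType.Exports.
Local Open Scope ring_scope.

(** Such an [x] is a value of the Lambert W function; the intermediate value theorem on [[0, K]]
    gives it, since [K <= K * expR K]. *)
Lemma exists_mul_expR (R : realType) (K : R) :
  0 <= K -> exists x, x * expR x = K.
Proof.
move=> K0.
have cf : {within `[0, K]%classic, continuous (fun x : R => x * expR x)}%classic.
  apply: continuous_subspaceT => x.
  by apply: cvgM; [exact: cvg_id | exact: continuous_expR].
have K_le : K <= K * expR K.
  by rewrite ler_peMr // -expR0 ler_expR.
have [|c _ <-] := IVT K0 cf (v := K); last by exists c.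
rewrite mul0r ge_min K0 /= le_max K_le orbT //.
Qed.

Section MnlPricing.
Variables (R : realType) (L : nat) (betap : R) (q D : option_seq L -> R).
Variable S : {fset option_seq L}.
Hypothesis betap_lt0 : betap < 0.

Lemma mnl_denom_gt0 (p : option_seq L -> R) :
  0 < 1 + \sum_(i <- S) expR (q i + betap * p i).
Proof. by rewrite ltr_pwDl // sumr_ge0 // => i _; exact: expR_ge0. Qed.

Lemma exists_optimal_level :
  exists r, \sum_(i <- S) expR (q i + betap * (D i + r) - 1) = - betap * r.
Proof.
pose K := \sum_(i <- S) expR (q i + betap * D i - 1).
have K0 : 0 <= K by apply: sumr_ge0 => i _; exact: expR_ge0.
have [x xK] := exists_mul_expR K0.
have b0 : betap != 0 by rewrite lt_eqF.
(* With [x = - betap * r], the factor [expR (- x)] comes out of the sum and the equation becomes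
   [K * expR (- x) = x]. *)
exists (- betap^-1 * x).
under eq_bigr => i _.
  have -> : q i + betap * (D i + - betap^-1 * x) - 1
            = (q i + betap * D i - 1) + - x by field.
  rewrite expRD; over.
rewrite -mulr_suml -/K -xK -mulrA -expRD subrr expR0.
by field.
Qed.

Variable r : R.
Hypothesis r_level :
  \sum_(i <- S) expR (q i + betap * (D i + r) - 1) = - betap * r.

(** With [z = - betap * (p i - D i - r)], each bracket [expR (z - 1) - z] is the gap between the
    exponential and its tangent at [0], taken at [z - 1]. Being nonnegative and zero only at
    [z = 1], these gaps yield both optimality and uniqueness without differentiating the revenue. *)
Lemma revenue_gap p :
  - betap * (1 + \sum_(i <- S) expR (q i + betap * p i))
    * (r - revenue (mnl betap q) S D p)
  = \sum_(i <- S) expR (q i + betap * p i)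
      * (expR (- betap * (p i - D i - r) - 1) - - betap * (p i - D i - r)).
Proof.
set E := \sum_(i <- S) _.
have E1 : 1 + E != 0 by rewrite gt_eqF // mnl_denom_gt0.
have revE : revenue (mnl betap q) S D p * (1 + E)
    = \sum_(i <- S) expR (q i + betap * p i) * (p i - D i).
  rewrite /revenue mulr_suml; apply: eq_bigr => i _; rewrite /mnl -/E.
  by field.
transitivity (- betap * r + - betap * r * E
              + betap * (revenue (mnl betap q) S D p * (1 + E))); first by ring.
(* Only the constant term [- betap * r] is expanded by the level equation; all terms are then sums
   over [S] and compare summand by summand. *)
rewrite revE -{1}r_level /E !mulr_sumr -!big_split /=; apply: eq_bigr => i _.
have -> : q i + betap * (D i + r) - 1
  = (q i + betap * p i) + (- betap * (p i - D i - r) - 1) by ring.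
by rewrite expRD; ring.
Qed.

Lemma tangent_gap_ge0 (z : R) : 0 <= expR (z - 1) - z.
Proof. by have := expR_ge1Dx (z - 1); lra. Qed.

Lemma revenue_le p : revenue (mnl betap q) S D p <= r.
Proof.
have E1 := mnl_denom_gt0 p.
have bE : 0 < - betap * (1 + \sum_(i <- S) expR (q i + betap * p i)).
  by rewrite mulr_gt0 // oppr_gt0.
rewrite -subr_ge0 -(pmulr_rge0 _ bE) revenue_gap.
by apply: sumr_ge0 => i _; rewrite mulr_ge0 ?expR_ge0 ?tangent_gap_ge0.
Qed.

Lemma revenue_eq p :
  revenue (mnl betap q) S D p = r
  <-> forall i, i \in S -> p i = D i + r - betap^-1.
Proof.
have b0 : betap != 0 by rewrite lt_eqF.
have E1 := mnl_denom_gt0 p.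
have gap := revenue_gap p.
split=> [rev_r i iS | p_opt].
  move: gap; rewrite rev_r subrr mulr0 => /esym/eqP.
  rewrite psumr_eq0 => [/allP/(_ i iS)|j _]; last first.
    by rewrite mulr_ge0 ?expR_ge0 ?tangent_gap_ge0.
  rewrite /= mulf_eq0 expR_eq0 /=; set z := - betap * _ => /eqP zE.
  (* The tangent inequality is strict away from the point of tangency. *)
  have z1 : z = 1.
    apply/eqP; rewrite -subr_eq0; apply/negPn/negP => /expR_gt1Dx.
    by move: zE; lra.
  have -> : p i = D i + r - z / betap by rewrite /z; field.
  by rewrite z1 mul1r.
move: gap; rewrite [RHS]big1_seq => [|i /andP[_ iS]]; last first.
  rewrite p_opt //; have -> : - betap * (D i + r - betap^-1 - D i - r) = 1.
    by field.
  by rewrite subrr expR0 subrr mulr0.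
move/eqP; rewrite !mulf_eq0 oppr_eq0 (negPf b0) (gt_eqF E1) /= subr_eq0.
by move/eqP.
Qed.

End MnlPricing.

Lemma max_revenue_mnl (R : realType) (L : nat) (betap : R)
    (q D : option_seq L -> R) (S : {fset option_seq L}) :
  betap < 0 ->
  max_revenue (mnl betap q) S D
  = - betap^-1
    * \sum_(i <- S) expR (q i + betap * opt_price (mnl betap q) S D i).
Proof.
move=> b_lt0; have b0 : betap != 0 by rewrite lt_eqF.
have [r r_level] := exists_optimal_level q D S b_lt0.
have rev_le := revenue_le b_lt0 r_level.
have rev_eq := revenue_eq b_lt0 r_level.
pose p0 i := D i + r - betap^-1.
have p0_opt : revenue (mnl betap q) S D p0 = r by apply/rev_eq.
have -> : max_revenue (mnl betap q) S D = r.
  apply/le_anti/andP; split.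
    by apply: ge_sup => [|_ [p _ <-]]; [exists r, p0 | exact: rev_le].
  apply: ub_le_sup; last by exists p0.
  by exists r => _ [p _ <-]; exact: rev_le.
(* The witness [p0] ensures that [xget] returns a maximizer and not its default. *)
have [_ opt_max] : argmax setT (revenue (mnl betap q) S D)
                     (opt_price (mnl betap q) S D).
  by apply: xgetPex; exists p0; split=> // p _; rewrite p0_opt rev_le.
have /rev_eq optE : revenue (mnl betap q) S D (opt_price (mnl betap q) S D) = r.
  by apply/le_anti; rewrite rev_le /= -[leLHS]p0_opt opt_max.
have -> : \sum_(i <- S) expR (q i + betap * opt_price (mnl betap q) S D i)
          = - betap * r.
  rewrite -r_level; apply: eq_big_seq => i iS; rewrite optE //.
  by congr expR; field.
by field.
Qed.

Lemma value_mnl (R : realType) (L : nat) (Omega : finType) (xi : 'I_L -> R)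
    (pX : Omega -> R) (mu betap : R) (q : Omega -> option_seq L -> R)
    (T : nat) (S : {fset option_seq L}) :
  betap < 0 ->
  value mu pX xi (fun w => mnl betap (q w)) T S
  = \sum_(i <- S) salvage xi i
    + mu * - betap^-1
      * \sum_(1 <= t < T.+1) \sum_(i <- S)
          expect pX (fun w => expR (opt_utility mu pX xi betap q S t w i)).
Proof.
move=> b_lt0; elim: T => [|T IH]; first by rewrite big_nil mulr0 addr0.
(* The new summand is [t = T.+1], whose opportunity costs use [value] at [t.-1 = T], as in the
   recursion. *)
rewrite big_nat_recr //= mulrDr addrA -IH -mulrA; congr (_ + mu * _).
rewrite /expect exchange_big mulr_sumr; apply: eq_bigr => w _ /=.
by rewrite max_revenue_mnl // -mulr_sumr mulrCA.
Qed.

(** Double counting: options have no repeated items, and each item lies in exactly one option of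
    [S]. *)
Lemma salvage_feasible (R : realType) (L : nat) (Kb Ks : int) (xi : 'I_L -> R)
    (S : {fset option_seq L}) :
  feasible Kb Ks S -> \sum_(i <- S) salvage xi i = \sum_j xi j.
Proof.
case=> opts parts _.
transitivity (\sum_(i <- S) \sum_j if j \in i then xi j else 0).
  apply: eq_big_seq => i /opts/and3P[uniq_i _ _].
  by rewrite -big_mkcond -big_uniq.
rewrite exchange_big; apply: eq_bigr => j _.
have [i [[iS ji] i_uniq]] := parts j.
rewrite (bigD1_seq i) ?fset_uniq //= ji big1_seq ?addr0 // => k /andP[ki kS].
by case: ifP => // jk; rewrite (i_uniq k) ?eqxx // in ki.
Qed.

Lemma le_lne_EFin (R : realType) (x y : R) :
  0 <= x -> 0 <= y -> (lne x%:E <= lne y%:E)%E = (x <= y).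
Proof.
by move=> x0 y0; rewrite lee_lne ?lee_fin // in_itv /= lee_fin ?leey ?x0 ?y0.
Qed.

Lemma argmax_le_mono (d d' : Order.disp_t) (A : Type) (B : porderType d)
    (B' : porderType d') (D : set A) (f : A -> B) (g : A -> B') :
  (forall x y, D x -> D y -> (f x <= f y)%O = (g x <= g y)%O) ->
  argmax D f = argmax D g.
Proof.
move=> fg; rewrite eqEsubset.
by split=> x [Dx xmax]; split=> // y Dy; [rewrite -fg | rewrite fg]; auto.
Qed.

Theorem theorem2 (R : realType) (L : nat) (Kb Ks : int) (Omega : finType)
    (xi : 'I_L -> R) (pX : Omega -> R) (mu betap : R)
    (q : Omega -> option_seq L -> R) (lambda : R)
    (pX_ge0 : forall w, 0 <= pX w) (pX_sum1 : \sum_w pX w = 1)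
    (mu_gt0 : 0 < mu) (mu_le1 : mu <= 1)
    (betap_lt0 : betap < 0) (lambda_ge0 : 0 <= lambda) :
  argmax (@feasible L Kb Ks)
    (value mu pX xi (fun w => mnl betap (q w)) (periods mu lambda))
  = argmax (@feasible L Kb Ks)
      (agg_utility mu pX xi betap q (periods mu lambda)).
Proof.
have c_gt0 : 0 < mu * - betap^-1 by rewrite mulr_gt0 // oppr_gt0 invr_lt0.
apply: argmax_le_mono => S S' S_feas S'_feas.
rewrite !value_mnl // !(salvage_feasible xi S_feas, salvage_feasible xi S'_feas).
rewrite lerD2l ler_pM2l // le_lne_EFin //;
  by do 3!apply: sumr_ge0 => ? _; rewrite mulr_ge0 ?expR_ge0.
Qed.
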